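(* Let $d=2k$ be a fixed even positive integer and let $j$ be an integer with $1\leq j\leq k-1$. Then there is a constant $c_j(d)>0$ such that, as $n\to\infty$, $$c_j(d)+o(1)\ \leq\ \frac{\mathrm{fmax}(d,n;j)}{\binom{n}{j+1}}\ \leq\ 1-\frac{1}{2^d}+o(1).$$
   Context: A polytope $P\subset\mathbb{R}^d$ is centrally symmetric if $P=-P$. $\mathrm{fmax}(d,n;j)$ denotes the maximum number of $j$-dimensional faces of a centrally symmetric $d$-dimensional polytope with $n$ vertices; it is defined for those $n$ for which such polytopes exist, and asymptotics are as $n\to\infty$ over such $n$. *)

(* Defs.v *)
From mathcomp Require Import all_boot all_order all_algebra.
From mathcomp Require Import all_classical all_reals all_analysis.

Set Implicit Arguments.
Unset Strict Implicit.
Unset Printing Implicit Defensive.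

Import Order.TTheory GRing.Theory Num.Theory.
Import numFieldNormedType.Exports.

Local Open Scope classical_set_scope.
Local Open Scope card_scope.
Local Open Scope ring_scope.

Section Polytopes.
Context {R : realType} {d : nat}.
Implicit Types (A P F : set 'rV[R]_d) (n m j : nat).

Definition convex_hull A : set 'rV[R]_d := smallest (@convex_set R 'rV[R]_d) A.

Definition affine_set A : Prop :=
  forall (x y : 'rV[R]_d) (t : R), A x -> A y -> A ((1 - t) *: x + t *: y).

Definition affine_hull A : set 'rV[R]_d := smallest affine_set A.

(* The dimension of a set is that of its affine hull. The empty set has no
   dimension in this sense; conventionally its dimension is -1. *)
Definition has_dim A m : Prop :=
  exists (x : 'rV[R]_d) (U : {vspace 'rV[R]_d}),
    affine_hull A = [set x + u | u in [set` U]] /\ \dim U = m.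

Definition polytope P : Prop :=
  exists2 V : set 'rV[R]_d, finite_set V & P = convex_hull V.

Definition centrally_symmetric P : Prop := P = [set - x | x in P].

(* Taking phi = 0 shows that P itself and the empty set are faces of P. *)
Definition face P F : Prop :=
  exists (phi : {scalar 'rV[R]_d}) (b : R),
    (forall x, P x -> phi x <= b) /\ F = P `&` [set x | phi x = b].

Definition faces j P : set (set 'rV[R]_d) :=
  [set F | face P F /\ has_dim F j].

(* The vertices are the 0-dimensional faces. *)
Definition cs_polytope n P : Prop :=
  [/\ polytope P, centrally_symmetric P, has_dim P d & faces 0%N P #= `I_n].

End Polytopes.

Definition cs_polytope_exists (R : realType) (d n : nat) : Prop :=
  exists P : set 'rV[R]_d, cs_polytope n P.

Definition face_numbers (R : realType) (d n j : nat) : set nat :=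
  [set m | exists2 P : set 'rV[R]_d, cs_polytope n P & faces j P #= `I_m].

(* The maximum of face_numbers R d n j; the default value 0 is only relevant
   when there is no centrally symmetric d-polytope with n vertices. *)
Definition fmax (R : realType) (d n j : nat) : nat :=
  xget 0%N [set m | face_numbers R d n j m /\
                    forall m', face_numbers R d n j m' -> (m' <= m)%N].

(* Main.v *)
(* Upper bound. Let P be a centrally symmetric d-polytope. If u, v are vertices
   with (u + v) / 2 in t P for some t < 1, then no proper face contains both.
   Vertices u_1, ..., u_N such that no (u_i - u_j) / 2 with i <> j lies in t P
   for any t < 1 give translates u_i + P inside 2 P with disjoint interiors, so
   N <= 2 ^ d. Hence, by the bound of Caro and Wei on independent sets applied to
   the pairs (u, -v), at least n ^ 2 / 2 ^ d of the ordered pairs of vertices lie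
   in no common proper face.
   A j-face is determined by any j + 1 linearly independent vertices spanning
   it, and averaging over pairs bounds the number of (j + 1)-sets of vertices
   all of whose pairs lie in proper faces.

   Lower bound. Take points x(t) = (2 - t) (1, t, ..., t ^ (d - 1)) for m values
   of t in [0, 1], together with their antipodes. Linear functionals restrict to
   the curve x as the polynomials of degree at most d that vanish at 2. For a
   set T of at most d / 2 parameters and g(t) = prod_(u in T) (t - u) ^ 2, the
   polynomial 1 - g(t) / g(2) is such a functional; it shows that the points
   x(u), u in T, are the vertices of a face. So a positive fraction of all sets
   of j + 1 vertices span faces. *)
From HB Require Import structures.
Require Import Defs.
From mathcomp Require Import all_boot all_order all_algebra.
From mathcomp Require Import zify ring lra finmap.

Set Implicit Arguments.
Unset Strict Implicit.
Unset Printing Implicit Defensive.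

Import Order.TTheory GRing.Theory Num.Theory.

Local Open Scope ring_scope.

(** * Finite graphs *)

(** If N > q, the Bernoulli-type bound [bern] lets N ^ m outgrow every constant multiple of q ^ m;
    the exponent m = q * C already gives a contradiction. *)
Lemma leq_of_geometric (N q C : nat) :
  (0 < q)%N -> (forall m, N ^ m <= C * q ^ m)%N -> (N <= q)%N.
Proof.
move=> q0 H; rewrite leqNgt; apply/negP => qN.
have bern m : (q ^ m * (q + m) <= q * q.+1 ^ m)%N.
  elim: m => [|m IH]; first by rewrite !expn0 addn0 mul1n muln1.
  rewrite !expnS.
  have : (q ^ m * q <= q * q.+1 ^ m)%N.
    by apply: leq_trans IH; rewrite leq_mul2l leq_addr orbT.
  by nia.
have h1 := bern (q * C)%N; have h2 := H (q * C)%N.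
have h3 : (q.+1 ^ (q * C) <= N ^ (q * C))%N by case: (q * C)%N => // m;
  rewrite leq_exp2r.
have h4 : (0 < q ^ (q * C))%N by rewrite expn_gt0 q0.
move: h1 h2 h3 h4; move: (q ^ _)%N (q.+1 ^ _)%N (N ^ _)%N => a b c; nia.
Qed.

(** Falling factorials are compared factor by factor: 2 m - i <= 4 (m - i) as soon as 3 i <= 2 m. *)
Lemma leq_bin_double (m j : nat) :
  (3 * j <= 2 * m)%N -> ('C(2 * m, j.+1) <= 4 ^ j.+1 * 'C(m, j.+1))%N.
Proof.
move=> jm; rewrite -(leq_pmul2r (fact_gt0 j.+1)) -mulnA !bin_ffact.
suff H i : (i <= j.+1 -> (2 * m) ^_ i <= 4 ^ i * m ^_ i)%N by exact: H.
elim: i => [|i IH] // ij.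
have -> : (4 ^ i.+1 * m ^_ i.+1 = (4 ^ i * m ^_ i) * (4 * (m - i)))%N.
  by rewrite ffactnSr expnSr mulnACA.
by rewrite ffactnSr leq_mul ?IH//; lia.
Qed.

Section FiniteGraphs.
Variable T : finType.
Implicit Types (e : rel T) (A S : {set T}).

(** The two-point orbits {x, s x} are removed one at a time, which requires the statement for all
    s-stable subsets. *)
Lemma involution_even (s : T -> T) :
  involutive s -> (forall x, s x != x) -> ~~ odd #|T|.
Proof.
move=> sK sN.
suff H m A : (#|A| <= m)%N -> {in A, forall x, s x \in A} -> ~~ odd #|A|.
  by rewrite -cardsT; apply: (H _ _ (leqnn _)) => x; rewrite !inE.
elim: m A => [|m IH] A.
  by rewrite leqn0 => /eqP ->.
have [->|[x xA]] := set_0Vmem A; first by rewrite cards0.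
move=> cA sA; have sxA : s x \in A :\ x by rewrite !inE sN sA.
rewrite (cardsD1 x) xA (cardsD1 (s x)) sxA /= negbK.
apply: IH.
  by move: cA; rewrite (cardsD1 x) xA (cardsD1 (s x)) sxA; lia.
move=> y; rewrite !inE => /and3P[ysx yx yA].
by rewrite sA // andbT (inj_eq (inv_inj sK)) yx /= -(inj_eq (inv_inj sK)) sK.
Qed.

(* Greedy choice: a vertex of minimum degree and its neighbours contribute at
   most 1 to the sum. *)
Lemma caro_wei (R : realFieldType) e A : reflexive e -> symmetric e ->
  exists I : {set T}, [/\ I \subset A, {in I &, forall x y, e x y -> x = y} &
    \sum_(x in A) (#|[set y in A | e x y]|%:R)^-1 <= #|I|%:R :> R].
Proof.
move=> er es.
have [m] := ubnP #|A|; elim: m A => // m IH A cA.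
have [->|[x0 x0A]] := set_0Vmem A.
  by exists set0; split; [exact: sub0set|move=> ? ?;
    rewrite inE|rewrite big_set0 cards0].
pose N A x := [set y in A | e x y].
have [x xA xmin] : exists2 x, x \in A &
    forall y, y \in A -> (#|N A x| <= #|N A y|)%N.
  by case: (arg_minnP (fun y => #|N A y|) x0A) => x xA h; exists x.
pose B := A :\: N A x.
have xN : x \in N A x by rewrite inE xA er.
have BA : B \subset A by exact: subsetDl.
have [I [IB Ii Ic]] : exists I : {set T}, [/\ I \subset B,
    {in I &, forall x y, e x y -> x = y} &
    \sum_(x in B) (#|N B x|%:R)^-1 <= #|I|%:R :> R].
  apply: IH; rewrite ltnS in cA; apply: leq_trans cA; apply: proper_card.
  by apply/properP; split=> //; exists x; rewrite // inE xN.
have xI : x \notin I by apply/negP => /(subsetP IB); rewrite inE xN.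
exists (x |: I); split.
- by rewrite subUset sub1set xA (subset_trans IB BA).
- have xeI y : y \in I -> ~~ e x y.
    by move=> /(subsetP IB); rewrite !inE => /andP[+ yA]; rewrite yA.
  move=> y z; rewrite !inE => /orP[/eqP->|yI] /orP[/eqP->|zI] //.
  + by move=> xz; move: (xeI _ zI); rewrite xz.
  + by rewrite es => xz; move: (xeI _ yI); rewrite xz.
  + exact: Ii.
rewrite cardsU1 xI natrD (big_setID (N A x)) /=; apply: lerD.
  have -> : A :&: N A x = N A x by apply/setIidPr/subsetP => y;
    rewrite inE => /andP[].
  have Nx : (0 < #|N A x|)%N by rewrite card_gt0; apply/set0Pn; exists x.
  apply: (@le_trans _ _ (\sum_(y in N A x) (#|N A x|%:R)^-1)).
    apply: ler_sum => y; rewrite inE => /andP[yA _].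
    by rewrite lef_pV2 ?posrE ?ltr0n ?ler_nat ?xmin // (leq_trans Nx) ?xmin.
  by rewrite sumr_const -[X in X <= _]mulr_natr mulVf // pnatr_eq0 -lt0n.
apply: le_trans Ic; apply: ler_sum => y yB.
have yN : (0 < #|N B y|)%N.
  by rewrite card_gt0; apply/set0Pn; exists y; rewrite inE yB er.
rewrite lef_pV2 ?posrE ?ltr0n // ?ler_nat.
  by apply: subset_leq_card; apply/subsetP => z;
    rewrite !inE => /andP[/andP[_ ->] ->].
by apply: (leq_trans yN); apply: subset_leq_card; apply/subsetP => z;
  rewrite !inE => /andP[/andP[_ ->] ->].
Qed.

(** [caro_wei] bounds the sum of inverse degrees by q. Convexity of 1 / x turns this into a lower
    bound for the sum of the degrees, which is the number of related ordered pairs. *)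
Lemma card_rel_ge e (q : nat) : reflexive e -> symmetric e ->
  (forall I : {set T}, {in I &, forall x y, e x y -> x = y} -> (#|I| <= q)%N) ->
  (#|T| ^ 2 <= q * #|[set p : T * T | e p.1 p.2]|)%N.
Proof.
move=> er es Hq.
have [I [_ /Hq Iq]] := caro_wei rat [set: T] er es.
set D := #|[set p : T * T | e p.1 p.2]|.
set n := #|T|.
have DE : D = (\sum_(x : T) #|[set y in [set: T] | e x y]|)%N.
  rewrite /D -sum1dep_card -(pair_big_dep xpredT e (fun _ _ => 1%N)) /=.
  by apply: eq_bigr => x _; rewrite -sum1dep_card; apply: eq_bigl => y;
    rewrite !inE.
rewrite (eq_bigl xpredT); last by move=> x; rewrite inE.
have [n0|n0] := posnP n; first by rewrite n0.
(* A singleton is independent, so q = 0 is impossible when T is nonempty. *)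
have [q0|q0] := posnP q.
  have /Hq : {in [set (enum_val (Ordinal n0) : T)] &, forall x y,
    e x y -> x = y}.
    by move=> x y /set1P -> /set1P ->.
  by rewrite cards1 q0.
move=> h; rewrite -(ler_nat rat) natrM natrX.
have nR : 0 < n%:R :> rat by rewrite ltr0n.
have qR : 0 < q%:R :> rat by rewrite ltr0n.
have IqR : #|I|%:R <= q%:R :> rat by rewrite ler_nat.
(* Tangent line of [1 / x] at [n / q], the extremal degree. *)
have tangent (x : T) :
    2 * (q%:R / n%:R) -
      #|[set y in [set: T] | e x y]|%:R * (q%:R / n%:R) ^+ 2 <=
    (#|[set y in [set: T] | e x y]|%:R)^-1 :> rat.
  have Nx : 0 < #|[set y in [set: T] | e x y]|%:R :> rat.
    by rewrite ltr0n card_gt0; apply/set0Pn; exists x; rewrite !inE er.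
  move: (#|_|%:R) Nx => a a0.
  rewrite -subr_ge0.
  have -> : a^-1 - (2 * (q%:R / n%:R) - a * (q%:R / n%:R) ^+ 2) =
      a * (a^-1 - q%:R / n%:R) ^+ 2.
    by field; rewrite !gt_eqF.
  by rewrite mulr_ge0 ?sqr_ge0 ?ltW.
have := le_trans (@ler_sum _ _ _ xpredT _ _ (fun x _ => tangent x))
  (le_trans h IqR).
rewrite sumrB sumr_const -mulr_suml -natr_sum -DE -[_ *+ _]mulr_natr
  -[#|xpredT|]/n => H.
have := ler_wpM2r (sqr_ge0 (n%:R : rat)) H.
have -> : (2 * (q%:R / n%:R) * n%:R - D%:R * (q%:R / n%:R) ^+ 2) * n%:R ^+ 2 =
   2 * q%:R * n%:R ^+ 2 - D%:R * q%:R ^+ 2 :> rat by field; rewrite gt_eqF.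
move=> {}H; rewrite -(ler_pM2l qR); move: H; lra.
Qed.

Definition clique e S := [forall x in S, forall y in S, (x != y) ==> e x y].

(** Double counting of ordered pairs inside cliques: a clique of size i + 2 contains (i + 2) (i + 1)
    of them, and a given pair lies in at most C(|T| - 2, i) sets of size i + 2. *)
Lemma card_cliques e i :
  (#|[set S : {set T} | (#|S| == i.+2) && clique e S]| * (i.+2 * i.+1) <=
   #|[set p : T * T | (p.1 != p.2) && e p.1 p.2]| * 'C(#|T| - 2, i))%N.
Proof.
set G := [set S : {set T} | _]; set E := [set p : T * T | _].
have pairs_in S : S \in G ->
    (i.+2 * i.+1 <= \sum_(p in E) ((p.1 \in S) && (p.2 \in S)))%N.
  rewrite inE => /andP[/eqP cS clS].
  have -> : (i.+2 * i.+1 = \sum_(x in S) \sum_(y in S :\ x) 1)%N.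
    rewrite -{1}cS -sum_nat_const; apply: eq_bigr => x xS.
    by rewrite sum1_card; move: cS; rewrite (cardsD1 x) xS => -[].
  rewrite pair_big_dep big_mkcond [leqRHS]big_mkcond;
    apply: leq_sum => -[x y] _ /=.
  rewrite !inE /=; case: ifP => // /and3P[xS yx yS].
  have /forall_inP/(_ _ xS)/forall_inP/(_ _ yS) := clS.
  by rewrite eq_sym yx xS yS /= => ->.
have sets_over p : p \in E ->
    (\sum_(S in G) ((p.1 \in S) && (p.2 \in S)) <= 'C(#|T| - 2, i))%N.
  case: p => x y; rewrite inE /= => /andP[xy _].
  rewrite -big_mkcondr /= sum1dep_card.
  have -> : (#|T| - 2 = #|~: [set x; y]|)%N.
    by rewrite -(cardsC [set x; y]) cards2 xy addKn.
  rewrite -cards_draws.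
  (* Removing x and y is injective on the sets that contain both. *)
  rewrite -(card_in_imset (f := fun S => S :\: [set x; y])).
    apply: subset_leq_card; apply/subsetP => B /imsetP[S];
      rewrite !inE => /and3P[/andP[/eqP cS _] xS yS] ->.
    rewrite subDset setUC; apply/andP; split.
      by apply/subsetP => z _; rewrite !inE orNb.
    have xyS : [set x; y] \subset S by rewrite subUset !sub1set xS yS.
    by rewrite cardsD (setIidPr xyS) cS cards2 xy subSS subSS subn0 eqxx.
  move=> S S'; rewrite !inE => /and3P[_ xS yS] /and3P[_ xS' yS'] /setP SS'.
  apply/setP => z; move: (SS' z); rewrite !inE.
  by case: (eqVneq z x) => [->|_];
    [rewrite xS xS'|case: (eqVneq z y) => [->|_ /=]; rewrite ?yS ?yS'].
rewrite -!sum_nat_const.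
apply: (@leq_trans (\sum_(S in G) \sum_(p in E) ((p.1 \in S) && (p.2 \in S)))).
  exact: leq_sum.
by rewrite exchange_big /=; apply: leq_sum.
Qed.

(** In the application [s] is the antipodal map and [e] is nearness. Two vertices of a common proper
    face satisfy ~~ e x (s y), so the vertex sets of such faces are cliques of this twisted
    relation. *)
Lemma card_cliques_le e (s : T -> T) (q i : nat) :
  involutive s -> reflexive e -> symmetric e ->
  (forall I : {set T}, {in I &, forall x y, e x y -> x = y} -> (#|I| <= q)%N) ->
  (forall x, ~~ e x (s x)) ->
  (q * #|[set S : {set T} |
          (#|S| == i.+2) && clique (fun x y => ~~ e x (s y)) S]|
    <= (q - 1) * 'C(#|T|, i.+2))%N.
Proof.
move=> sK er es Hq esN; have := card_cliques (fun x y => ~~ e x (s y)) i.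
set G := #|[set S : {set T} | _]|; set E := #|[set p | _]| => cG.
have := card_rel_ge er es Hq; set D := #|_| => cD.
(* Reindexing the second entry by [s] preserves the number of pairs, and [esN] keeps the reindexed
   pairs off the diagonal. They are disjoint from the pairs counted by E. *)
have ED : (E + D <= #|T| * (#|T| - 1))%N.
  have -> : D = #|[set p : T * T | e p.1 (s p.2)]|.
    rewrite /D -(card_imset _ (f := fun p => (p.1, s p.2))).
      apply: eq_card => -[x y]; apply/imsetP/idP => [[[x' y']]|].
        by rewrite !inE /= => + [-> ->]; rewrite sK.
      by rewrite inE /= => exy; exists (x, s y); rewrite ?inE //= sK.
    by move=> [x y] [x' y'] [-> /(inv_inj sK) ->].
  have -> : (#|T| * (#|T| - 1) = #|[set p : T * T | p.1 != p.2]|)%N.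
    have -> : [set p : T * T | p.1 != p.2] = ~: [set (x, x) | x : T].
      apply/setP => -[x y]; rewrite in_set in_setC; congr (~~ _).
      by apply/eqP/imsetP => /= [<-|[z _ [-> ->]]] //; exists x.
    have := cardsC [set (x, x) | x : T]; rewrite card_imset;
      last by move=> x y [].
    by rewrite card_prod cardT -cardE; nia.
  rewrite -cardsUI; have -> : [set p | (p.1 != p.2) && ~~ e p.1 (s p.2)] :&:
      [set p : T * T | e p.1 (s p.2)] = set0.
    by apply/setP => p; rewrite !inE; case: (e _ _); rewrite ?andbF.
  rewrite cards0 addn0; apply: subset_leq_card; apply/subsetP => -[x y].
  rewrite !inE /= => /orP[/andP[]//|exy]; apply/eqP => xy.
  by move: (esN x); rewrite {2}xy exy.
have binE : (#|T| * (#|T| - 1) * 'C(#|T| - 2, i) =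
    i.+2 * i.+1 * 'C(#|T|, i.+2))%N.
  have -> : (#|T| - 2 = #|T|.-1.-1)%N by lia.
  by rewrite -mulnA subn1 mul_bin_diag mulnCA mul_bin_diag mulnA
    [(i.+1 * _)%N]mulnC.
have n2 : (#|T| * (#|T| - 1) <= #|T| ^ 2)%N by rewrite -mulnn leq_mul2l
  leq_subr orbT.
(* Here q D >= |T| ^ 2 >= |T| (|T| - 1) is subtracted from q times the bound on E + D. *)
have qE : (q * E <= (q - 1) * (#|T| * (#|T| - 1)))%N.
  have := leq_mul (leqnn q) ED; rewrite mulnBl mul1n mulnDr => qED.
  by move: qED cD n2; move: (_ ^ 2)%N (_ * (_ - 1))%N => a b; lia.
rewrite -(leq_pmul2r (isT : 0 < i.+2 * i.+1)%N) -!mulnA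
  [('C(_, _) * _)%N]mulnC -binE.
rewrite [leqRHS]mulnA; apply: leq_trans (leq_mul qE (leqnn _)).
by rewrite -mulnA leq_mul2l cG orbT.
Qed.

End FiniteGraphs.

(* Imported only now because [set0] and [subsetP] refer to finite sets above. *)
From mathcomp Require Import all_classical all_reals all_analysis.

Import numFieldNormedType.Exports.

Local Open Scope classical_set_scope.
Local Open Scope ring_scope.

(** * Convex hulls and faces *)

Section ConvexGeometry.
Context {R : realType} {d : nat}.
Notation E := 'rV[R]_d.
Implicit Types (A P F V : set E) (phi psi : {scalar E}) (b t : R) (s : seq E).

Lemma convex_setP A : convex_set (A : set (convex_lmodType E)) <->
  forall x y t, 0 <= t <= 1 -> A x -> A y -> A (t *: x + (1 - t) *: y).
Proof.
split=> [cA x y t /andP[t0 t1] Ax Ay|cA x y l /set_mem Ax /set_mem Ay].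
  by have := cA x y (Itv01 t0 t1); rewrite !inE; apply.
by rewrite inE; apply: cA => //; rewrite ge0 le1.
Qed.

Lemma sub_convex_hull A : A `<=` convex_hull A.
Proof. exact: sub_gen_smallest. Qed.

Lemma convex_hull_convex A x y t : 0 <= t <= 1 ->
  convex_hull A x -> convex_hull A y -> convex_hull A (t *: x + (1 - t) *: y).
Proof.
move=> t01 Ax Ay C [cC AC]; apply: (convex_setP C).1 => //.
- by apply: Ax; split.
- by apply: Ay; split.
Qed.

Lemma convex_hull_min A C : A `<=` C ->
  (forall x y t, 0 <= t <= 1 -> C x -> C y -> C (t *: x + (1 - t) *: y)) ->
  convex_hull A `<=` C.
Proof. by move=> AC cC x; apply; split=> //; apply/convex_setP. Qed.

Lemma convex_hullS A B : A `<=` B -> convex_hull A `<=` convex_hull B.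
Proof.
by move=> AB; apply: convex_hull_min (@convex_hull_convex _) =>
  x /AB /sub_convex_hull.
Qed.

Lemma convex_hull_le phi b A :
  (forall x, A x -> phi x <= b) -> forall x, convex_hull A x -> phi x <= b.
Proof.
move=> Ab; apply: convex_hull_min => // x y t t01 xb yb.
rewrite linearD !linearZ /=; nra.
Qed.

Lemma convex_hull_span (W : {vspace E}) A :
  A `<=` [set` W] -> convex_hull A `<=` [set` W].
Proof.
by move=> AW; apply: convex_hull_min => // x y t _ xW yW; apply: memvD;
  apply: memvZ.
Qed.

Lemma convex_hull1 (v : E) : convex_hull [set v] = [set v].
Proof.
apply/seteqP; split=> [|x ->]; last exact: sub_convex_hull.
apply: convex_hull_min => // x y t _ -> ->.
by rewrite -scalerDl addrC subrK scale1r.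
Qed.

Lemma convex_hull0 : convex_hull (set0 : set E) = set0.
Proof. by apply/seteqP; split=> //; apply: convex_hull_min. Qed.

(** The points with phi < b, together with the hull of the maximisers in A, form a convex set
    containing A. A combination with weights strictly between 0 and 1 has phi < b as soon as one
    endpoint does. *)
Lemma convex_hull_face phi b A : (forall x, A x -> phi x <= b) ->
  convex_hull A `&` [set x | phi x = b] =
  convex_hull (A `&` [set x | phi x = b]).
Proof.
move=> Ab; apply/seteqP; split; last first.
  move=> x Fx; split; first by apply: convex_hullS Fx => y [].
  move: x Fx; apply: convex_hull_min => [x []//|x y t _ /= xb yb].
  by rewrite linearD !linearZ /= xb yb; ring.
pose F := convex_hull (A `&` [set x | phi x = b]).
suff H x : convex_hull A x -> phi x < b \/ phi x = b /\ F x.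
  by move=> x [/H[lt_b /= eq_b|[]//]]; rewrite eq_b ltxx in lt_b.
move: x; apply: convex_hull_min => [x Ax|x y t /andP[t0 t1]].
  have := Ab x Ax; rewrite le_eqVlt => /orP[/eqP xb|]; last by left.
  by right; split=> //; apply: sub_convex_hull.
have [->|t0'] := eqVneq t 0; first by rewrite scale0r add0r subr0 scale1r.
have [->|t1'] := eqVneq t 1; first by rewrite subrr scale0r addr0 scale1r.
have {t0'}t0' : 0 < t by rewrite lt_neqAle eq_sym t0'.
have {t1'}t1' : t < 1 by rewrite lt_neqAle t1'.
rewrite linearD !linearZ /= => -[xb|[xb Fx]] [yb|[yb Fy]];
  [left; nra|left; nra|left; nra|right].
split; first by rewrite xb yb; ring.
by apply: convex_hull_convex => //; rewrite t0 t1.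
Qed.

End ConvexGeometry.

(** * Affine hulls and dimension *)

Section Dimension.
Context {R : realType} {d : nat}.
Notation E := 'rV[R]_d.
Implicit Types (A P F V : set E) (phi psi : {scalar E}) (b t : R) (X Y : seq E).

Lemma sub_affine_hull A : A `<=` affine_hull A.
Proof. exact: sub_gen_smallest. Qed.

Lemma affine_hull_affine A : affine_set (affine_hull A).
Proof.
by move=> x y t Ax Ay C CA; apply: CA.1; [exact: Ax|exact: Ay].
Qed.

Lemma affine_hull_min A C : A `<=` C -> affine_set C -> affine_hull A `<=` C.
Proof. by move=> AC aC; apply: smallest_sub. Qed.

Lemma has_dim_neq0 A m : has_dim A m -> A !=set0.
Proof.
move=> [x [U [AE _]]]; have [A0|/set0P//] := eqVneq A set0.
have : affine_hull A x by rewrite AE; exists 0; rewrite ?addr0 //= mem0v.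
by rewrite A0 => /(_ set0)[]; split=> // y z t [].
Qed.

(** The direction space is recovered as the set of differences of points of the affine hull. *)
Lemma has_dim_inj A m m' : has_dim A m -> has_dim A m' -> m = m'.
Proof.
move=> [x [U [AU <-]]] [y [V [AV <-]]].
have sub (x1 x2 : E) (U1 U2 : {vspace E}) :
    [set x1 + u | u in [set` U1]] = [set x2 + u | u in [set` U2]] ->
    (U1 <= U2)%VS.
  move=> eqU; apply/subvP => u uU.
  have [v vU vx] : [set x2 + u | u in [set` U2]] x1.
    by rewrite -eqU; exists 0; rewrite ?addr0 //= mem0v.
  have [w wU wx] : [set x2 + u | u in [set` U2]] (x1 + u) by rewrite -eqU;
    exists u.
  have -> : u = w - v.
    by apply: (addrI x1); rewrite -wx -vx -addrA [v + _]addrC subrK.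
  exact: memvB.
have eqUV : [set x + u | u in [set` U]] = [set y + u | u in [set` V]] by
  rewrite -AU.
by congr (\dim _); apply: subv_anti;
  rewrite (sub _ _ _ _ eqUV) (sub _ _ _ _ (esym eqUV)).
Qed.

Lemma has_dim0P A : has_dim A 0 <-> exists v, A = [set v].
Proof.
split=> [dA|[v ->]]; last first.
  exists v, 0%VS; rewrite dimv0; split=> //; apply/seteqP; split.
    apply: affine_hull_min => [_ ->|]; first by exists 0;
      rewrite ?addr0 //= mem0v.
    move=> _ _ t [_ /= /[!memv0]/eqP-> <-] [_ /= /[!memv0]/eqP-> <-].
    by exists 0; rewrite /= ?mem0v // addr0 -scalerDl subrK scale1r.
  by move=> _ [_ /= /[!memv0]/eqP-> <-]; rewrite addr0; apply: sub_affine_hull.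
have [v Av] := has_dim_neq0 dA; exists v; apply/seteqP; split=> [w Aw|_ -> //].
have [x [U [AE /eqP]]] := dA; rewrite dimv_eq0 => /eqP U0; move: AE;
  rewrite U0 => AE.
have H z : A z -> z = x.
  by move=> /sub_affine_hull; rewrite AE => -[_ /= /[!memv0]/eqP-> <-];
    rewrite addr0.
by rewrite /= (H _ Av) (H _ Aw).
Qed.

Lemma affine_hull_dirZ A x0 z t : affine_hull A x0 -> affine_hull A (x0 + z) ->
  affine_hull A (x0 + t *: z).
Proof.
move=> Ax0 Az; have := affine_hull_affine t Ax0 Az.
by rewrite scalerDr addrA -scalerDl subrK scale1r.
Qed.

(** The point x0 + (y + z) is the midpoint of x0 + 2 y and x0 + 2 z. *)
Lemma affine_hull_dirD A x0 y z : affine_hull A x0 -> affine_hull A (x0 + y) ->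
  affine_hull A (x0 + z) -> affine_hull A (x0 + (y + z)).
Proof.
move=> Ax0 /(affine_hull_dirZ 2 Ax0) Ay /(affine_hull_dirZ 2 Ax0) Az.
have := affine_hull_affine 2^-1 Ay Az.
rewrite !scalerDr addrACA -scalerDl subrK scale1r !scalerA mulVf // scale1r.
by rewrite (_ : (1 - 2^-1) * 2 = 1) ?scale1r //; field.
Qed.

(** Applying phi to a linear combination of points of X that lies on the hyperplane phi = b shows
    that its coefficients sum to 1, since b is nonzero. So linear combinations there are affine
    ones. *)
Lemma affine_hull_span phi b X F : b != 0 -> F !=set0 ->
  [set` X] `<=` F -> F `<=` [set x | x \in <<X>>%VS /\ phi x = b] ->
  affine_hull F = [set x | x \in <<X>>%VS /\ phi x = b].
Proof.
move=> b0 [x0 Fx0] XF FX; apply/seteqP; split.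
  apply: affine_hull_min => // x y t [xX xb] [yX yb]; split;
    first by rewrite memvD ?memvZ.
  by rewrite linearD !linearZ /= xb yb; ring.
move=> w [wX wb].
have Ax0 : affine_hull F x0 by exact: sub_affine_hull.
suff : affine_hull F (x0 + (w - x0)) by rewrite addrC subrK.
have := coord_span (X := in_tuple X) wX;
  set c := fun i => coord (in_tuple X) i w => wE.
have cX (i : 'I_(size X)) : (in_tuple X)`_i \in X by rewrite mem_nth.
have sum1 : \sum_i c i = 1.
  apply: (mulIf b0); rewrite mul1r -{2}wb [in RHS]wE linear_sum mulr_suml.
  by apply: eq_bigr => i _; rewrite linearZ /=;
    have [_ ->] := FX _ (XF _ (cX i)).
have -> : w - x0 = \sum_i c i *: ((in_tuple X)`_i - x0).
  rewrite (eq_bigr (fun i => c i *: (in_tuple X)`_i - c i *: x0));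
    last by move=> i _; rewrite scalerBr.
  by rewrite sumrB -scaler_suml sum1 scale1r -wE.
apply: (big_ind (fun z => affine_hull F (x0 + z))) => [|y z|i _].
- by rewrite addr0.
- exact: affine_hull_dirD.
apply: affine_hull_dirZ => //; rewrite addrC subrK.
exact: sub_affine_hull (XF _ (cX i)).
Qed.

(** The direction space is the kernel of phi in the span of X. It has codimension one there because
    phi takes the nonzero value b. *)
Lemma has_dim_span phi b X F : b != 0 -> F !=set0 ->
  [set` X] `<=` F -> F `<=` [set x | x \in <<X>>%VS /\ phi x = b] ->
  has_dim F (\dim <<X>>).-1.
Proof.
move=> b0 F0 XF FX; have AE := affine_hull_span b0 F0 XF FX.
have [x0 Fx0] := F0; have [x0X x0b] := FX _ Fx0.
pose f : 'Hom(E, R^o) := linfun (phi : E -> R^o).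
have fE x : f x = phi x by rewrite lfunE.
exists x0, (<<X>> :&: lker f)%VS; split.
  rewrite AE; apply/seteqP; split=> [x [xX xb]|_ [u /= uU <-]].
    exists (x - x0); last by rewrite addrC subrK.
    by rewrite /= memv_cap memvB //= memv_ker fE linearB /= xb x0b subrr.
  move: uU; rewrite memv_cap memv_ker fE => /andP[uX /eqP u0].
  by split; [rewrite memvD|rewrite linearD /= u0 x0b addr0].
have := limg_ker_dim f <<X>>;
  suff -> : \dim (f @: <<X>>) = 1%N by rewrite addn1 => <-.
apply/eqP; rewrite eqn_leq; apply/andP; split.
  by apply: leq_trans (dimvS (subvf _)) _; rewrite dimvf.
rewrite lt0n dimv_eq0; apply/negP => /eqP f0.
by have := memv_img f x0X; rewrite f0 memv0 fE x0b (negPf b0).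
Qed.

Lemma free_subseq X :
  exists Y, [/\ {subset Y <= X}, free Y & <<Y>>%VS = <<X>>%VS].
Proof.
elim: X => [|x X [Y [YX fY sY]]]; first by exists [::]; rewrite nil_free.
have [xY|xY] := boolP (x \in <<Y>>%VS).
  exists Y; split=> //; first by move=> y /YX; rewrite inE orbC => ->.
  by rewrite span_cons -sY; apply/esym/addv_idPr; rewrite -memvE.
exists (x :: Y); rewrite free_cons xY fY !span_cons sY; split=> // y.
by rewrite !inE => /orP[->//|/YX ->]; rewrite orbT.
Qed.

Lemma eq_on_span phi psi X :
  {in X, phi =1 psi} -> {in <<X>>%VS, phi =1 psi}.
Proof.
move=> eX x xX; rewrite (coord_span (X := in_tuple X) xX) !linear_sum.
by apply: eq_bigr => i _; rewrite !linearZ /= eX // mem_nth.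
Qed.

End Dimension.

(** * Vertices and supporting functionals *)

Section Faces.
Context {R : realType} {d : nat}.
Notation E := 'rV[R]_d.
Implicit Types (A P F V : set E) (phi psi : {scalar E}) (b t : R).
Implicit Types (s X Y : seq E).

Definition vertex P : set E := [set v | face P [set v]].

Lemma scalar_ex (f : E -> R) : scalar f -> exists phi : {scalar E}, phi =1 f.
Proof.
move=> fl; pose L := GRing.isLinear.Build R E R *%R f fl.
by exists (HB.pack f L : {scalar E}).
Qed.

(** With p the projection that kills W, some coordinate i of p x is nonzero; psi y = (p x)_i (p y)_i
    vanishes on W and is a nonzero square at x. *)
Lemma scalar_separating (W : {vspace E}) x : x \notin W ->
  exists2 psi : {scalar E}, {in W, forall y, psi y = 0} & 0 < psi x.
Proof.
move=> xW; pose p := (\1 - projv W)%VF : 'End(E).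
have pE y : p y = y - projv W y by rewrite add_lfunE opp_lfunE id_lfunE.
have : p x != 0.
  by apply: contra xW; rewrite pE subr_eq0 => /eqP ->; apply: memv_proj.
move=> /rV0Pn[i pi].
have [|psi psiE] := @scalar_ex (fun y => p x 0 i * p y 0 i).
  by move=> c y z; rewrite linearP /= !mxE; ring.
exists psi => [y yW|]; last by rewrite psiE -expr2 exprn_even_gt0.
by rewrite psiE (pE y) projv_id // subrr mxE mulr0.
Qed.

Lemma seq_max (f : E -> R) s x :
  x \in s -> exists2 y, y \in s & {in s, forall z, f z <= f y}.
Proof.
elim: s x => // a [|c s] IH x.
  by move=> _; exists a; rewrite ?mem_head // => z /[!inE]/eqP->.
move=> _; have [y ys ymax] := IH c (mem_head _ _).
have [fa|/ltW fa] := leP (f a) (f y).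
  by exists y => [|z]; rewrite inE; [rewrite ys orbT|move=> /orP[/eqP->|/ymax]].
by exists a => [|z]; rewrite inE ?eqxx // => /orP[/eqP->|/ymax /le_trans ->].
Qed.

(* Lexicographic optimisation: on a finite set, maximising [phi] and then [psi]
   amounts to maximising [phi + e * psi] for a small [e]. *)
Lemma lexicographic_face s phi b psi M :
  {in s, forall z, phi z <= b} -> {in s, forall z, phi z = b -> psi z <= M} ->
  exists (phi' : {scalar E}) (b' : R), {in s, forall z, phi' z <= b'} /\
    {in s, forall z, phi' z = b' <-> phi z = b /\ psi z = M}.
Proof.
move=> phib psiM.
have [e e0 He] : exists2 e : R, 0 < e &
    {in s, forall z, phi z < b -> e * (psi z - M) < b - phi z}.
  elim: s {phib psiM} => [|a s [e e0 He]]; first by exists 1.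
  (* The added 1 keeps the denominator positive and the required inequality at [a] strict. Points
     with phi = b impose no condition on e. *)
  pose e' := (b - phi a) / (`|psi a - M| + 1).
  have N0 : 0 < `|psi a - M| + 1 by rewrite ltr_wpDl.
  have [ba|ba] := ltP (phi a) b; last first.
    by exists e => // z /[!inE] /orP[/eqP->|/He//]; rewrite ltNge ba.
  have e'0 : 0 < e' by rewrite divr_gt0 // subr_gt0.
  exists (Num.min e e'); first by rewrite lt_min e0 e'0.
  have m0 : 0 < Num.min e e' by rewrite lt_min e0 e'0.
  move=> z /[!inE] /orP[/eqP->|zs] zb.
    apply: (@le_lt_trans _ _ (Num.min e e' * `|psi a - M|)).
      by rewrite ler_pM2l // ler_norm.
    apply: (@lt_le_trans _ _ (Num.min e e' * (`|psi a - M| + 1))).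
      by rewrite ltr_pM2l // ltrDl.
    by rewrite -ler_pdivlMr // ge_min lexx orbT.
  have [p0|p0] := ltP 0 (psi z - M).
    by apply: le_lt_trans (He _ zs zb); rewrite ler_pM2r // ge_min lexx.
  apply: (@le_lt_trans _ _ 0); last by rewrite subr_gt0.
  by rewrite pmulr_rle0.
have [|phi' phi'E] := @scalar_ex (fun z => phi z + e * psi z).
  by move=> c y z; rewrite !linearP /=; ring.
exists phi', (b + e * M); split=> z zs; rewrite phi'E.
  have := phib _ zs; rewrite le_eqVlt => /orP[/eqP zb|zb].
    by rewrite zb lerD2l ler_pM2l // psiM.
  by have := He _ zs zb; lra.
split=> [zM|[-> ->] //].
have := phib _ zs; rewrite le_eqVlt => /orP[/eqP zb|zb].
  by split=> //; move: zM; rewrite zb => /addrI/mulfI; apply; rewrite gt_eqF.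
by have := He _ zs zb; lra.
Qed.

Lemma face_polytope s phi b :
  (forall x, convex_hull [set` s] x -> phi x <= b) ->
  convex_hull [set` s] `&` [set x | phi x = b] =
  convex_hull [set` [seq x <- s | phi x == b]].
Proof.
move=> sb; rewrite convex_hull_face; last by move=> x /sub_convex_hull/sb.
congr convex_hull; apply/seteqP; split=> x /=; rewrite mem_filter.
  by move=> [-> /= ->]; rewrite eqxx.
by move=> /andP[/eqP].
Qed.

(** The face {v} is the hull of the points of [s] on it. There is at least one such point, and it
    must be v. *)
Lemma vertex_sub s : vertex (convex_hull [set` s]) `<=` [set` s].
Proof.
move=> v [phi [b [sb]]]; rewrite face_polytope // => vE.
case fE : [seq x <- s | phi x == b] => [|w r].
  have nil0 : [set` ([::] : seq E)] = set0 by apply/seteqP; split.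
  by have := erefl v : [set v] v; rewrite vE fE nil0 convex_hull0.
have : w \in [seq x <- s | phi x == b] by rewrite fE mem_head.
move=> ws; have : [set v] w by rewrite vE; apply: sub_convex_hull.
by move=> <-; move: ws; rewrite mem_filter => /andP[].
Qed.

(** Induction on the number of entries of [s] on the face. If two points x and y on it differ, a
    functional psi with psi x < psi y is maximised as a second criterion; the smaller face obtained
    loses x. *)
Lemma face_has_vertex s phi b x :
  {in s, forall z, phi z <= b} -> x \in s -> phi x = b ->
  exists v, [/\ vertex (convex_hull [set` s]) v, v \in s & phi v = b].
Proof.
have [m] := ubnP (count (fun z => phi z == b) s).
elim: m phi b x => // m IH phi b x; rewrite ltnS => cm sb xs xb.
have [/allP H|] := boolP (all (fun z => (phi z == b) ==> (z == x)) s).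
  exists x; split=> //; exists phi, b.
  have sb' z : convex_hull [set` s] z -> phi z <= b by exact: convex_hull_le.
  split=> //; rewrite face_polytope // -[LHS]convex_hull1; congr convex_hull.
  apply/seteqP; split=> z /=; rewrite mem_filter; first by move=> ->;
    rewrite xb eqxx.
  by move=> /andP[zb /H]; rewrite zb => /eqP.
rewrite -has_predC => /hasP[y ys /=]; rewrite negb_imply => /andP[/eqP yb yx].
have [|psi _ psi_yx] := @scalar_separating 0%VS (y - x);
  first by rewrite memv0 subr_eq0.
have [|z] := @seq_max psi [seq z <- s | phi z == b] x;
  first by rewrite mem_filter xb eqxx.
rewrite mem_filter => /andP[/eqP zb zs] zmax.
have [|phi' [b' [sb' eqb']]] := @lexicographic_face s phi b psi (psi z) sb.
  by move=> w ws wb; apply: zmax; rewrite mem_filter wb eqxx.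
have [||v [vP vs vb]] := IH phi' b' z _ sb' zs; last 2 first.
- by apply/eqb'.
- by exists v; split=> //; have [] := (eqb' _ vs).1 vb.
apply: leq_trans cm; rewrite -(size_filter (fun z => phi z == b)).
rewrite (@eq_in_count _ _
  (predI (fun w => psi w == psi z) (fun w => phi w == b))); last first.
  move=> w ws /=; apply/eqP/andP => [/(eqb' _ ws)[-> ->]//|[/eqP wz /eqP wb]].
  by apply/eqb'.
rewrite -count_filter -[X in (_ < X)%N](count_predC (fun w => psi w == psi z)).
rewrite -addn1 leq_add2l -has_count; apply/hasP.
have psixy : psi x < psi y by rewrite -subr_gt0 -linearB.
exists x; first by rewrite mem_filter xb eqxx.
rewrite /= lt_eqF // (lt_le_trans psixy) // zmax // mem_filter yb eqxx //.
Qed.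

(* Otherwise a functional vanishing on the vertices in the face but positive
   somewhere on the face would attain its maximum over the face on a smaller
   face, and that face contains a vertex. *)
Lemma face_span_vertices s X phi b :
  vertex (convex_hull [set` s]) = [set` X] ->
  (forall x, convex_hull [set` s] x -> phi x <= b) ->
  convex_hull [set` s] `&` [set x | phi x = b] `<=`
    [set` <<[seq v <- X | phi v == b]>>%VS].
Proof.
move=> XE sb; rewrite face_polytope //; apply: convex_hull_span => x /=.
set W := <<_>>%VS; rewrite mem_filter => /andP[/eqP xb xs].
apply/negPn/negP => /scalar_separating[psi psi0 psix].
have [|z] := @seq_max psi [seq z <- s | phi z == b] x;
  first by rewrite mem_filter xb eqxx.
rewrite mem_filter => /andP[/eqP zb zs] zmax.
have sb' : {in s, forall z, phi z <= b} by move=> w ws; apply: sb;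
  apply: sub_convex_hull.
have [|phi' [b' [sb'' eqb']]] := @lexicographic_face s phi b psi (psi z) sb'.
  by move=> w ws wb; apply: zmax; rewrite mem_filter wb eqxx.
have [|v [vP vs vb]] := face_has_vertex sb'' zs; first by apply/eqb'.
have [vb' vz] := (eqb' _ vs).1 vb.
have : psi v = 0.
  apply/psi0/memv_span; rewrite mem_filter vb' eqxx /=.
  by have : [set` X] v by rewrite -XE.
move=> v0; have := zmax x; rewrite mem_filter xb eqxx xs => /(_ isT).
by rewrite -vz v0 leNgt psix.
Qed.

End Faces.

(** * Packing *)

Section Dilates.
Context {R : realType} {d : nat}.
Notation E := 'rV[R]_d.
Implicit Types (x y : E) (s t : R).

(** For t >= 0 this plays the role of the ball of radius t about 0 in the norm with unit ball P;
    [dilateD] and [dilateZ] are then the triangle inequality and homogeneity. *)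
Definition dilate (P : set E) t : set E := [set t *: p | p in P].

Variable P : set E.
Hypothesis P_convex : forall x y t,
  0 <= t <= 1 -> P x -> P y -> P (t *: x + (1 - t) *: y).
Hypothesis P_sym : forall x, P x -> P (- x).
Hypothesis P0 : P 0.

Lemma dilate_mono s t x : 0 <= s <= t -> dilate P s x -> dilate P t x.
Proof.
move=> /andP[s0 st] [p Pp <-]; have [t0|t0] := eqVneq t 0.
  have -> : s = 0 by apply/eqP; rewrite eq_le s0 -t0 st.
  by exists p; rewrite // t0.
have {}t0 : 0 < t by rewrite lt_neqAle eq_sym t0 (le_trans s0).
exists ((s / t) *: p + (1 - s / t) *: 0).
  by apply: P_convex => //; rewrite divr_ge0 ?(ltW t0) //= ler_pdivrMr ?mul1r.
by rewrite scaler0 addr0 scalerA mulrCA divff ?gt_eqF // mulr1.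
Qed.

Lemma dilate0 t : 0 <= t -> dilate P t 0.
Proof. by exists 0; rewrite // scaler0. Qed.

Lemma dilateD s t x y : 0 <= s -> 0 <= t ->
  dilate P s x -> dilate P t y -> dilate P (s + t) (x + y).
Proof.
move=> s0 t0 Px Py; have [st|st] := eqVneq (s + t) 0.
  move: st => /eqP; rewrite paddr_eq0 // => /andP[/eqP s_0 /eqP t_0].
  move: Px Py; rewrite s_0 t_0 addr0 => -[p Pp <-] [q Pq <-].
  by exists 0; rewrite // !scale0r addr0.
have {}st : 0 < s + t by rewrite lt_neqAle eq_sym st addr_ge0.
have [p Pp <-] := Px; have [q Pq <-] := Py.
exists ((s / (s + t)) *: p + (1 - s / (s + t)) *: q).
  by apply: P_convex => //;
    rewrite divr_ge0 ?(ltW st) //= ler_pdivrMr ?mul1r ?lerDl.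
rewrite scalerDr !scalerA; congr (_ *: _ + _ *: _); field; exact: lt0r_neq0.
Qed.

Lemma dilateN t x : dilate P t x -> dilate P t (- x).
Proof. by move=> [p /P_sym Pp <-]; exists (- p); rewrite // scalerN. Qed.

Lemma dilateZ c t x : dilate P t x -> dilate P (`|c| * t) (c *: x).
Proof.
have H a : 0 <= a -> dilate P t x -> dilate P (a * t) (a *: x).
  by move=> _ [p Pp <-]; exists p; rewrite // scalerA.
have [c0|c0] := leP 0 c; first by rewrite ger0_norm //; exact: H.
by move=> Px; rewrite ltr0_norm // -[c in c *: x]opprK scaleNr; apply: dilateN;
  apply: H; rewrite // oppr_ge0 ltW.
Qed.

Lemma dilate_sum (I : Type) (r : seq I) (f : I -> R) (x : I -> E) :
  (forall i, 0 <= f i /\ dilate P (f i) (x i)) ->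
  dilate P (\sum_(i <- r) f i) (\sum_(i <- r) x i).
Proof.
move=> H; elim: r => [|i r IH]; first by rewrite !big_nil; apply: dilate0.
rewrite !big_cons; have [f0 Pi] := H i; apply: dilateD => //.
by apply: sumr_ge0 => k _; case: (H k).
Qed.

(** Expanding in X puts each unit vector e_i into some multiple k_i P; any K above the sum of the
    k_i works. This compares the sup norm with the norm of P. *)
Lemma dilate_absorbing (X : seq E) : [set` X] `<=` P -> <<X>>%VS = fullv ->
  exists2 K : nat, (0 < K)%N &
    forall B x, 0 <= B -> (forall i, `|x 0 i| <= B) -> dilate P (K%:R * B) x.
Proof.
move=> XP Xfull.
have abs x : exists t, 0 <= t /\ dilate P t x.
  have xX : x \in <<X>>%VS by rewrite Xfull memvf.
  exists (\sum_i (`|coord (in_tuple X) i x| * 1)); split.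
    by apply: sumr_ge0 => i _; rewrite mulr1.
  rewrite [x in dilate _ _ x](coord_span (X := in_tuple X) xX).
  apply: dilate_sum => i; split; first by rewrite mulr1.
  by apply: dilateZ; exists (in_tuple X)`_i; rewrite ?scale1r //; apply: XP;
    rewrite /= mem_nth.
have /choice[k kP] : forall i : 'I_d,
    exists t, 0 <= t /\ dilate P t (delta_mx 0 i) by [].
have [K K0 KE] : exists2 K : nat, (0 < K)%N & \sum_i k i <= K%:R.
  exists (Num.bound (\sum_i k i)).+1 => //;
    apply/ltW/(lt_trans (archi_boundP _)); rewrite ?ltr_nat //.
  by apply: sumr_ge0 => i _; case: (kP i).
exists K => // B x B0 xB.
apply: (@dilate_mono (\sum_i `|x 0 i| * k i)).
  rewrite sumr_ge0 => [|i _]; last by rewrite mulr_ge0 //; case: (kP i).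
  apply: (@le_trans _ _ ((\sum_i k i) * B)); last by rewrite ler_wpM2r.
  rewrite mulr_suml; apply: ler_sum => i _; rewrite mulrC ler_wpM2l //;
    by case: (kP i).
rewrite [x in dilate _ _ x]row_sum_delta; apply: dilate_sum => i.
have [ki0 ki] := kP i; split; first by rewrite mulr_ge0.
exact: dilateZ.
Qed.

(* Danzer and Gruenbaum's bound. Instead of comparing volumes, iterate: the
   points [\sum_i 2 ^ i *: u (w i)] indexed by the N ^ m words [w] of length [m]
   are again pairwise far apart and lie in [2 ^ m *: P], where a count of the
   cells of a cubic grid leaves room for only O(2 ^ (d * m)) of them. *)
Lemma card_separated_le (K M N : nat) (u : 'I_N -> E) : (0 < K)%N ->
  (forall B x, 0 <= B -> (forall i, `|x 0 i| <= B) -> dilate P (K%:R * B) x) ->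
  (forall x i, P x -> `|x 0 i| <= M%:R) ->
  (forall i, P (u i)) ->
  (forall i j t, i != j -> 0 <= t < 2 -> ~ dilate P t (u i - u j)) ->
  (N <= 2 ^ d)%N.
Proof.
move=> K0 PK PM Pu u_far.
pose p := foldr (fun i a => u i + 2 *: a) (0 : E).
have p_in w : dilate P (2 ^+ size w - 1) (p w).
  elim: w => [|i w IH] /=; first by rewrite expr0 subrr; apply: dilate0.
  have -> : 2 ^+ (size w).+1 - 1 = 1 + `|2| * (2 ^+ size w - 1) :> R.
    by rewrite ger0_norm // exprS; ring.
  apply: dilateD => //.
  - by rewrite mulr_ge0 // subr_ge0 exprn_ege1 // ler1n.
  - by exists (u i); rewrite ?scale1r.
  - exact: dilateZ.
have p_far w w' t : size w = size w' -> w != w' -> 0 <= t < 2 ->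
    ~ dilate P t (p w - p w').
  elim: w w' t => [|i w IH] [|i' w'] t //= [sw] ww' /andP[t0 t2].
  have [ww|ww] := eqVneq w w'.
    have ii' : i != i' by apply: contra ww' => /eqP ->; rewrite ww.
    by rewrite ww opprD addrACA subrr addr0; apply: u_far; rewrite ?t0.
  move=> Pt.
  (* As u i' - u i lies in 2 P, a difference of the long words in t P would put the difference of
     their tails in (t / 2 + 1) P, and t / 2 + 1 < 2. *)
  have Pii : dilate P (1 + 1) (u i' - u i).
    by apply: dilateD => //; [exists (u i')|exists (- u i); first exact: P_sym];
      rewrite ?scale1r.
  have := dilateZ 2^-1 (dilateD t0 (addr_ge0 ler01 ler01) Pt Pii).
  have -> : 2^-1 *: (u i + 2 *: p w - (u i' + 2 *: p w') + (u i' - u i)) =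
      p w - p w'.
    by apply/rowP => k; rewrite !mxE; field.
  by move=> Pw; apply: (IH w' _ sw ww _ Pw); rewrite ger0_norm ?invr_ge0 //;
    lra.
apply: (@leq_of_geometric _ _ ((2 * (K * M) + 1) ^ d));
  first by rewrite expn_gt0.
move=> m; rewrite -expnM [(d * m)%N]mulnC expnM -expnMn.
pose B := (K * M * 2 ^ m)%N.
pose D := ((2 * (K * M) + 1) * 2 ^ m)%N.
have BD : (2 * B < D)%N.
  by rewrite /B /D mulnDl mul1n mulnA -[ltnLHS]addn0 ltn_add2l expn_gt0.
have pB (w : m.-tuple 'I_N) i : `|K%:R * p w 0 i| <= B%:R.
  have [q Pq <-] := p_in w.
  rewrite normrM mxE normrM /B natrM natrM ger0_norm // -mulrA ler_wpM2l //
    mulrC.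
  rewrite ler_pM // ?PM // natrX size_tuple ger0_norm ?subr_ge0 ?exprn_ege1
    ?ler1n //.
  by rewrite gerBl.
(* The grid has mesh 1 / K. Coordinates of K p(w) lie in [-B, B], so after the shift by B every cell
   index is below D. *)
pose cell (w : m.-tuple 'I_N) (i : 'I_d) := Num.truncn (K%:R * p w 0 i + B%:R).
have cell_ge0 (w : m.-tuple 'I_N) i : 0 <= K%:R * p w 0 i + B%:R.
  by have := pB w i; rewrite ler_norml => /andP[]; lra.
have cell_lt w i : (cell w i < D)%N.
  rewrite truncn_lt_nat //; apply: (@le_lt_trans _ _ (2 * B)%:R);
    last by rewrite ltr_nat.
  by have := pB w i; rewrite ler_norml natrM => /andP[]; lra.
pose h w := [ffun i => Ordinal (cell_lt w i)].
have h_inj : injective h.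
  (* Two words in one cell differ by at most 1 / K in each coordinate, hence by an element of P,
     against [p_far] with t = 1. *)
  move=> w w' /ffunP hh; apply/val_inj/eqP/negPn/negP => ww.
  have KR : 0 < K%:R :> R by rewrite ltr0n.
  apply: (@p_far w w' 1 _ ww); rewrite ?size_tuple ?ler01 ?ltr1n //.
  have <- : K%:R * K%:R^-1 = 1 :> R by rewrite divff ?gt_eqF.
  apply: PK => [|i]; first by rewrite invr_ge0 ltW.
  have /(congr1 val) := hh i; rewrite !ffunE /= => cc.
  have := truncn_itv (cell_ge0 w i); have := truncn_itv (cell_ge0 w' i).
  rewrite -[Num.truncn _]cc -natr1 => /andP[h1 h2] /andP[h3 h4].
  rewrite -(ler_pM2l KR) divff ?gt_eqF // -{1}(ger0_norm (ltW KR)) -normrM.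
  by rewrite ler_norml !mxE mulrDr mulrN; lra.
by have := leq_card h h_inj; rewrite card_tuple card_ffun !card_ord.
Qed.

End Dilates.

(** * Faces of centrally symmetric polytopes *)

Section UpperBound.
Context {R : realType} {d : nat}.
Notation E := 'rV[R]_d.
Implicit Types (x y v : E) (phi : {scalar E}) (b t : R) (X Y : seq E).
Variable s : seq E.
Let P : set E := convex_hull [set` s].
Hypothesis d_gt0 : (0 < d)%N.
Hypothesis P_cs : centrally_symmetric P.
Hypothesis P_dim : has_dim P d.

Lemma cs_opp x : P x -> P (- x).
Proof. by move=> Px; rewrite P_cs; exists x. Qed.

Lemma cs_0 x : P x -> P 0.
Proof.
move=> Px.
have h01 : 0 <= (2^-1 : R) <= 1 by rewrite invr_ge0 ler0n invf_le1 ?ler1n.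
have <- : 2^-1 *: x + (1 - 2^-1) *: - x = 0 by apply/rowP => i; rewrite !mxE;
  field.
exact: convex_hull_convex h01 Px (cs_opp Px).
Qed.

(** The affine hull of P has dimension d, hence is the whole space, and it is contained in the span
    of [s]. *)
Lemma cs_span : span s = fullv.
Proof.
have [x [U [PE dU]]] := P_dim.
have U_full : U = fullv.
  by apply/eqP; rewrite eqEdim subvf dU dimvf /dim /= mul1n leqnn.
apply: subv_anti; rewrite subvf; apply/subvP => y _.
have : affine_hull P y.
  by rewrite PE U_full; exists (y - x); rewrite /= ?memvf // addrC subrK.
apply: (@affine_hull_min _ _ P [set` span s]);
  first by apply: convex_hull_span => z /memv_span.
by move=> z w t zs ws; rewrite /= memvD ?memvZ.
Qed.

Lemma cs_bounded : exists M : nat, forall x i, P x -> `|x 0 i| <= M%:R.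
Proof.
have [M HM] : exists M : nat, forall x i, x \in s -> `|x 0 i| <= M%:R.
  rewrite /P; elim: s => [|v r [M HM]]; first by exists 0%N.
  pose m := Num.bound (\sum_i `|v 0 i|);
    exists (maxn M m) => x i /[!inE] /orP[/eqP->|xr].
    apply: (@le_trans _ _ m%:R); last by rewrite ler_nat leq_maxr.
    apply/ltW/(le_lt_trans _ (archi_boundP _)); last by apply: sumr_ge0.
    by rewrite (bigD1 i) //= lerDl sumr_ge0.
  by apply: le_trans (HM _ _ xr) _; rewrite ler_nat leq_maxl.
exists M => x i; move: x.
apply: convex_hull_min => [x|x y t /andP[t0 t1]] /=; first exact: HM.
rewrite !mxE => xM yM; apply: le_trans (ler_normD _ _) _.
by rewrite !normrM (ger0_norm t0) (@ger0_norm _ (1 - t)) ?subr_ge0 //; nra.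
Qed.

(** If b <= 0, the bound at x, -x, y and -y forces phi = b = 0 on all of P, so the face would be P
    itself, of dimension d. *)
Lemma cs_face_gt0 phi b m : (forall x, P x -> phi x <= b) ->
  has_dim (P `&` [set x | phi x = b]) m -> m != d -> 0 < b.
Proof.
move=> Pb Fm md; have [x [Px /= xb]] := has_dim_neq0 Fm.
rewrite ltNge; apply/negP => b0.
suff FP : P `&` [set x | phi x = b] = P.
  by case/eqP: md; apply: has_dim_inj P_dim; rewrite -FP.
apply/seteqP; split=> [y []//|y Py]; split=> //=.
have := Pb _ Py; have := Pb _ (cs_opp Py); have := Pb _ (cs_opp Px).
by rewrite !linearN /= xb; lra.
Qed.

(** On t P the functional is at most t b < 2 b, the value of phi at x + y. *)
Lemma cs_face_far phi b t x y : (forall x, P x -> phi x <= b) -> 0 < b ->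
  phi x = b -> phi y = b -> 0 <= t < 2 -> ~ dilate P t (x + y).
Proof.
move=> Pb b0 xb yb /andP[t0 t2] [p /Pb pb] /(congr1 phi).
by rewrite linearZ linearD /= xb yb; nra.
Qed.

Lemma vertexN v : vertex P v -> vertex P (- v).
Proof.
move=> [phi [b [Pb vE]]].
have [|psi psiE] := @scalar_ex R d (fun x => - phi x); first by move=> c y z;
  rewrite linearP /=; ring.
exists psi, b; split=> [x /cs_opp/Pb|]; first by rewrite psiE linearN.
apply/seteqP; split=> [_ ->|x [/cs_opp Px]] /=; rewrite psiE.
  have [Pv /= vb] : (P `&` [set x | phi x = b]) v by rewrite -vE.
  by split; [exact: cs_opp|rewrite linearN opprK].
move=> xb; have : [set v] (- x) by rewrite vE; split=> //=; rewrite linearN.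
by move=> <-; rewrite opprK.
Qed.

Lemma vertex_supporting v : vertex P v ->
  exists phi b, [/\ forall x, P x -> phi x <= b, 0 < b & phi v = b].
Proof.
move=> [phi [b [Pb vE]]]; exists phi, b; split=> //.
  apply: (cs_face_gt0 Pb (m := 0%N)); last by rewrite eq_sym -lt0n.
  by rewrite -vE; apply/has_dim0P; exists v.
by have [] : (P `&` [set x | phi x = b]) v by rewrite -vE.
Qed.

(** The vertices on a face span it linearly. Since the face lies on phi = b with b > 0, its linear
    span has dimension j + 1, and a basis can be extracted from those vertices. *)
Lemma face_basis X j F : vertex P = [set` X] -> (j < d)%N -> faces j P F ->
  exists Y, [/\ {subset Y <= X}, [set` Y] `<=` F, free Y, size Y = j.+1 &
    F `<=` [set` <<Y>>%VS]].
Proof.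
move=> XE jd [[phi [b [Pb FE]]] Fj].
have b0 : 0 < b by apply: (cs_face_gt0 Pb (m := j));
  [rewrite -FE|rewrite ltn_eqF].
pose Z := [seq v <- X | phi v == b].
have FZ : F `<=` [set` <<Z>>%VS] by rewrite FE; apply: face_span_vertices.
have ZF : [set` Z] `<=` F.
  move=> z; rewrite FE /= mem_filter => /andP[/eqP zb zX]; split=> //.
  have vz : vertex P z by rewrite XE.
  exact: sub_convex_hull (vertex_sub vz).
have [x Fx] := has_dim_neq0 Fj.
have dimZ : \dim <<Z>> = j.+1.
  have := @has_dim_span R d phi b Z F (lt0r_neq0 b0) (ex_intro _ x Fx) ZF.
  move=> /(_ _)/(has_dim_inj Fj) -> => [|z Fz]; last by split;
    [exact: FZ|move: Fz; rewrite FE => -[]].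
  rewrite prednK // lt0n dimv_eq0; apply/negP => /eqP Z0.
  have := FZ x Fx; rewrite Z0 /= memv0 => /eqP x0.
  by move: Fx; rewrite FE x0 => -[_ /=]; rewrite linear0 => b_0;
    rewrite -b_0 ltxx in b0.
have [Y [YZ fY sY]] := free_subseq Z; exists Y; split=> //.
- by move=> y /YZ; rewrite mem_filter => /andP[].
- by move=> y /YZ; apply: ZF.
- by move: dimZ; rewrite -sY => /eqP; rewrite (eqnP fY) => /eqP.
- by rewrite sY.
Qed.

(** On the span of Y the functionals phi' and (b' / b) phi agree, because they agree on Y; so phi =
    b implies phi' = b' there. Consequently a face is determined by a basis chosen among its
    vertices. *)
Lemma face_sub_span Y j F F' : (j < d)%N -> faces j P F -> faces j P F' ->
  [set` Y] `<=` F -> [set` Y] `<=` F' -> F `<=` [set` <<Y>>%VS] -> F `<=` F'.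
Proof.
move=> jd [[phi [b [Pb FE]]] Fj] [[phi' [b' [Pb' FE']]] Fj'] YF YF' FY x Fx.
have b0 : 0 < b by apply: (cs_face_gt0 Pb (m := j));
  [rewrite -FE|rewrite ltn_eqF].
have [|psi psiE] := @scalar_ex R d (fun x => b' / b * phi x);
  first by move=> c y z; rewrite linearP /=; ring.
have : phi' x = psi x.
  apply: (eq_on_span _ (FY _ Fx)) => y yY; have := YF y yY; have := YF' y yY.
  by rewrite FE FE' psiE => -[_ /= ->] [_ /= ->]; rewrite mulfVK // gt_eqF.
move: Fx; rewrite FE FE' psiE => -[Px /= ->] phi'x.
by split=> //=; rewrite phi'x mulfVK // gt_eqF.
Qed.

End UpperBound.

(** * Counting faces: parity and the upper bound *)

Section FaceNumbers.
Context {R : realType} {d : nat}.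
Notation E := 'rV[R]_d.
Implicit Types (P : set E) (X : {fset E}).

Lemma faces0E P : faces 0 P = [set [set v] | v in vertex P].
Proof.
apply/seteqP; split=> [F [FP /has_dim0P[v vE]]|_ [v vP <-]].
  by exists v; rewrite // /vertex /= -vE.
by split=> //; apply/has_dim0P; exists v.
Qed.

Lemma cs_polytope_vertices n P : cs_polytope n P ->
  exists (s : seq E) X, [/\ P = convex_hull [set` s],
    vertex P = [set` X] & #|` X| = n].
Proof.
move=> [[V /finite_seqP[s ->] ->] _ _]; rewrite faces0E.
set P0 := convex_hull _.
have set1_inj : {in vertex P0 &, injective (fun v : E => [set v])}.
  by move=> v w _ _ vw; have : [set v] v by []; rewrite vw.
rewrite (card_eql (inj_card_eq set1_inj)) => Vn.
have /finite_fsetP[X XE] : finite_set (vertex P0) by apply/finite_setP;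
  exists n.
by exists s, X; split=> //; apply/card_eq_fsetP; rewrite -XE.
Qed.

(** The antipodal map as a total function on a finite type, fixing x when its antipode is not in
    X. *)
Definition fopp X (x : X) : X := insubd x (- val x).

Lemma val_fopp X (x : X) :
  (forall v, v \in X -> - v \in X) -> val (fopp x) = - val x.
Proof. by move=> XN; rewrite /fopp val_insubd XN ?fsvalP //. Qed.

(** The antipodal map on the vertices has no fixed point, since a supporting functional is positive
    at its vertex. So only even n have to be matched by the construction. *)
Lemma cs_polytope_even n P : (0 < d)%N -> cs_polytope n P -> ~~ odd n.
Proof.
move=> d0 Pn; have [s [X [PE XE <-]]] := cs_polytope_vertices Pn.
have [_ Pcs Pdim _] := Pn; rewrite PE in Pcs Pdim XE.
have XN v : v \in X -> - v \in X.
  move=> vX; have : [set` X] v by [].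
  by rewrite -XE => /(vertexN Pcs); rewrite XE.
rewrite cardfE; apply: (@involution_even _ (@fopp X)) => x.
  by apply: val_inj; rewrite !val_fopp // opprK.
apply/negP => /eqP/(congr1 val); rewrite val_fopp // => xN.
have [|phi [b [_ b0 vb]]] := @vertex_supporting _ _ s d0 Pcs Pdim (val x).
  by rewrite XE /= fsvalP.
by have := congr1 phi xN; rewrite linearN vb /=; lra.
Qed.

(** The number m is existential because finiteness of the set of faces is part of the claim: it
    follows from the injection into sets of vertices. *)
Lemma card_faces_le n i P : (i.+1 < d)%N -> cs_polytope n P ->
  exists m, (faces i.+1 P #= `I_m)%card /\
    (2 ^ d * m <= (2 ^ d - 1) * 'C(n, i.+2))%N.
Proof.
move=> id Pn; have d0 : (0 < d)%N by apply: leq_ltn_trans id.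
have [s [X [PE XE <-]]] := cs_polytope_vertices Pn.
have [_ Pcs Pdim _] := Pn; rewrite PE in Pcs Pdim XE *.
set P0 := convex_hull _ in Pcs Pdim XE *.
have XN v : v \in X -> - v \in X.
  move=> vX; have : [set` X] v by [].
  by rewrite -XE => /(vertexN Pcs); rewrite XE.
have Xs (x : X) : val x \in s.
  by apply: (@vertex_sub _ _ s); rewrite -/P0 XE /= fsvalP.
have XP (x : X) : P0 (val x) by apply: sub_convex_hull; apply: Xs.
have P0convex x y (t : R) :
    0 <= t <= 1 -> P0 x -> P0 y -> P0 (t *: x + (1 - t) *: y).
  exact: convex_hull_convex.
have P0sym x : P0 x -> P0 (- x) by exact: cs_opp.
have P00 : P0 0 by have [z /(cs_0 Pcs)] := has_dim_neq0 Pdim.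
have [K K0 PK] := dilate_absorbing P0convex P0sym P00 (@sub_convex_hull _ _ _)
  (cs_span Pdim).
have [M PM] := @cs_bounded _ _ s.
(* Nearness: distance less than 2 in the norm of P. Independent sets are then 2-separated, as
   [card_separated_le] requires. *)
pose e (x y : X) := `[< exists2 t : R,
  0 <= t < 2 & dilate P0 t (val x - val y) >].
have ee : reflexive e.
  by move=> x; apply/asboolP; exists 0; rewrite ?lexx ?ltr0n // subrr;
    apply: dilate0.
have es : symmetric e.
  by move=> x y; apply/asboolP/asboolP => -[t t2 /(dilateN P0sym)];
    rewrite opprB; exists t.
have card_indep (I : {set X}) :
    {in I &, forall x y, e x y -> x = y} -> (#|I| <= 2 ^ d)%N.
  move=> I_indep.
  apply: (card_separated_le P0convex P0sym P00 (u := fun k : 'I_#|I| =>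
    val (enum_val k)) K0 PK PM) => //.
  move=> k l t kl t2 Pt; move/eqP: kl; apply; apply: enum_val_inj.
  by apply: I_indep; rewrite ?enum_valP //; apply/asboolP; exists t.
have foppK : involutive (@fopp X) by move=> x; apply: val_inj;
  rewrite !val_fopp // opprK.
have e_far x y (phi : {scalar E}) (b : R) :
    (forall z, P0 z -> phi z <= b) -> 0 < b ->
    phi (val x) = b -> phi (val y) = b -> ~~ e x (fopp y).
  move=> Pb b0 xb yb; apply/negP => /asboolP[t t2];
    rewrite val_fopp // opprK => Pt.
  exact: (cs_face_far Pb b0 xb yb t2 Pt).
have e_opp x : ~~ e x (fopp x).
  have [|phi [b [Pb b0 vb]]] := @vertex_supporting _ _ s d0 Pcs Pdim (val x).
    by rewrite XE /= fsvalP.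
  exact: (@e_far _ _ phi b).
have := card_cliques_le i foppK ee es card_indep e_opp.
set G := finset _; rewrite -cardfE => cG.
(* S encodes F: a set of i + 2 vertices on F that spans F linearly and belongs to the family of
   cliques G. *)
pose good (F : set E) (S : {set X}) := [/\ S \in G,
  [set` [seq val x | x <- enum S]] `<=` F &
  F `<=` [set` span [seq val x | x <- enum S]]].
have /choice[S SP] : forall F, exists S, faces i.+1 P0 F -> good F S.
  move=> F; have [FP|nF] := pselect (faces i.+1 P0 F);
    last by exists finset.set0.
  have [Y [YX YF fY sY FY]] := face_basis Pcs Pdim XE id FP.
  pose S : {set X} := finset (fun x : X => val x \in Y); exists S => _.
  have SY : [seq val x | x <- enum S] =i Y.
    move=> y; apply/mapP/idP => [[x + ->]|yY]; first by rewrite mem_enum inE.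
    by exists [` YX _ yY]%fset; rewrite // mem_enum inE.
  split; last 2 first.
  - by move=> y /=; rewrite SY => /YF.
  - by move=> y /FY; rewrite /= (eq_span SY).
  have cS : #|S| = i.+2.
    rewrite -sY cardE -(size_map val); apply/perm_size/uniq_perm => //;
      last exact: free_uniq.
    by rewrite map_inj_uniq ?enum_uniq //; apply: val_inj.
  rewrite inE cS eqxx /=; have [[phi [b [Pb FE]]] Fi] := FP.
  have b0 : 0 < b by apply: (cs_face_gt0 Pcs Pdim Pb (m := i.+1));
    [rewrite -FE|rewrite ltn_eqF].
  apply/forall_inP => x; rewrite inE => /YF; rewrite FE => -[_ /= xb].
  apply/forall_inP => y; rewrite inE => /YF; rewrite FE => -[_ /= yb].
  by apply/implyP => _; apply: e_far Pb b0 xb yb.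
set A := faces i.+1 P0.
have S_inj : {in A &, injective S}.
  move=> F F' /set_mem AF /set_mem AF' SS.
  have [_ SF FS] := SP _ AF; have [_ SF' FS'] := SP _ AF';
    rewrite -SS in SF' FS'.
  apply/seteqP; split.
    exact: (face_sub_span Pcs Pdim id AF AF' SF SF' FS).
  exact: (face_sub_span Pcs Pdim id AF' AF SF' SF FS').
have fSA : finite_set (S @` A) by exact: finite_finset.
have SA := inj_card_eq S_inj.
have /finite_setP[m Am] : finite_set A.
  by apply: card_le_finite fSA; move: SA; rewrite card_eq_le => /andP[].
exists m; split=> //; apply: leq_trans cG; rewrite leq_mul2l; apply/orP; right.
rewrite -(@card_fset_set _ (S @` A) m) ?(card_eql SA) // cardE.
apply: uniq_leq_size => // T;
  rewrite in_fset_set // mem_enum => /set_mem[F AF <-].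
by have [] := SP _ AF.
Qed.

End FaceNumbers.

(** * A polytope with many faces *)

Section Construction.
Context {R : realType} {d : nat}.
Notation E := 'rV[R]_d.
Implicit Types (phi : {scalar E}) (t u : R) (r T : seq R) (p : {poly R}).

Definition curve t : E := \row_a ((2 - t) * t ^+ a).

(** Writing p = q (X - 2), the coefficients of q, negated because the curve carries the factor 2 -
    t, are those of the functional. *)
Lemma curve_functional p : (size p <= d.+1)%N -> root p 2 ->
  exists phi, forall t, phi (curve t) = p.[t].
Proof.
move=> sp /factor_theorem[q pE].
have sq : (size q <= d)%N.
  have [->|q0] := eqVneq q 0; first by rewrite size_poly0.
  by move: sp; rewrite pE size_Mmonic ?monicXsubC // size_XsubC addn2.
have [|phi phiE] := @scalar_ex R d (fun x => - \sum_(a < d) q`_a * x 0 a).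
  move=> c x y; rewrite mulrN -opprD mulr_sumr -big_split /=; congr (- _).
  by apply: eq_bigr => a _; rewrite !mxE; ring.
exists phi => t; rewrite phiE pE hornerM hornerXsubC (horner_coef_wide _ sq).
rewrite mulr_suml -sumrN; apply: eq_bigr => a _; rewrite mxE; ring.
Qed.

(** The polynomial (X - 2) times the product of X - u over the other parameters u gives a functional
    that vanishes at their points but not at [curve t]. *)
Lemma curve_free r :
  uniq r -> 2 \notin r -> (size r <= d)%N -> free (map curve r).
Proof.
elim: r => [|t r IH] /=; first by rewrite nil_free.
move=> /andP[tr ur]; rewrite inE negb_or => /andP[t2 r2] sr.
rewrite free_cons IH ?(ltnW sr) // andbT; apply/negP => t_span.
pose p := ('X - 2%:P) * \prod_(u <- r) ('X - u%:P).
have [||phi phiE] := @curve_functional p.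
- rewrite /p size_Mmonic ?monic_prod_XsubC // -?size_poly_eq0 ?size_XsubC //.
  by rewrite size_prod_XsubC.
- by rewrite rootM root_XsubC eqxx.
have [|zero zeroE] := @scalar_ex R d (fun=> 0); first by move=> c x y;
  rewrite mulr0 addr0.
have : phi (curve t) = zero (curve t).
  apply: (eq_on_span _ t_span) => _ /mapP[u ur' ->]; rewrite phiE zeroE.
  by apply/rootP; rewrite rootM root_prod_XsubC ur' orbT.
by rewrite phiE zeroE => /rootP;
  rewrite rootM root_XsubC root_prod_XsubC eq_sym (negPf t2) (negPf tr).
Qed.

(* [1 - g / g 2], where [g] is the product of the squares [(X - u) ^ 2], lies
   between 0 and 1 on [0, 1], takes the value 1 exactly at the points of [T],
   and vanishes at 2. *)
Lemma curve_supporting T :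
  (2 * size T <= d)%N -> {in T, forall u, 0 <= u <= 1} ->
  exists phi, forall t, 0 <= t <= 1 ->
    0 <= phi (curve t) <= 1 /\ (phi (curve t) == 1) = (t \in T).
Proof.
move=> sT T01; pose g := \prod_(u <- T) ('X - u%:P) ^+ 2 : {poly R}.
have gE t : g.[t] = \prod_(u <- T) (t - u) ^+ 2.
  by rewrite horner_prod; apply: eq_bigr => u _; rewrite horner_exp hornerXsubC.
have g2 : 0 < g.[2].
  rewrite gE big_seq; apply: prodr_gt0 => u /T01 /andP[u0 u1].
  by rewrite exprn_even_gt0 //= subr_eq0 gt_eqF // (le_lt_trans u1) // ltr1n.
have [||phi phiE] := @curve_functional (1 - g.[2]^-1 *: g).
- apply: leq_trans (size_polyD _ _) _; rewrite size_polyN size_poly1 geq_max /=.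
  apply: leq_trans (size_scale_leq _ _) _.
  rewrite /g prodrXl; apply: leq_trans (size_poly_exp_leq _ _) _.
  by rewrite size_prod_XsubC /= ltnS mulnC.
- by apply/rootP; rewrite !hornerE mulVf ?subrr // gt_eqF.
exists phi => t /andP[t0 t1]; rewrite phiE !hornerE.
have gt0 : 0 <= g.[t] by rewrite gE prodr_ge0 // => u _; rewrite sqr_ge0.
have gt2 : g.[t] <= g.[2].
  rewrite !gE big_seq [leRHS]big_seq; apply: ler_prod => u /T01 /andP[u0 u1].
  by rewrite sqr_ge0 /=; nra.
split.
  by rewrite subr_ge0 gerBl mulrC ler_pdivrMr // mul1r gt2 divr_ge0 // ltW.
rewrite -subr_eq0 addrAC subrr add0r oppr_eq0 mulf_eq0 invr_eq0 (gt_eqF g2) /=.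
rewrite gE prodf_seq_eq0; apply/hasP/idP => [[u uT /=]|tT].
  by rewrite expf_eq0 /= subr_eq0 => /eqP ->.
by exists t; rewrite //= subrr expr0n.
Qed.

End Construction.

Lemma card_eq_uniq_seq (T : choiceType) (s : seq T) :
  uniq s -> ([set` s] #= `I_(size s))%card.
Proof.
move=> us; have -> : [set` s] = [set` [fset x in s]%fset].
  by apply/seteqP; split=> x /=; rewrite inE.
by apply/card_eq_fsetP; rewrite card_fseq undup_id.
Qed.

(** * The symmetric hull of points on the curve *)

Section LowerBound.
Context {R : realType} {d : nat}.
Notation E := 'rV[R]_d.
Implicit Types (phi : {scalar E}) (t u : R) (T : seq R).
Variable r : seq R.
Hypothesis r_uniq : uniq r.
Hypothesis r01 : {in r, forall t, 0 <= t <= 1}.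
Hypothesis d_ge2 : (1 < d)%N.

Let V : seq E := map curve r ++ map (fun t => - curve t) r.
Let P : set E := convex_hull [set` V].

(** The functional of [curve_supporting] is nonpositive at the antipodal points, so none of them
    reaches the value 1. *)
Lemma sym_curve_supporting T : {subset T <= r} -> (2 * size T <= d)%N ->
  exists phi, [/\ forall x, P x -> phi x <= 1,
    {in r, forall t, 0 <= phi (curve t) /\ (phi (curve t) == 1) = (t \in T)} &
    P `&` [set x | phi x = 1] = convex_hull [set` map curve T]].
Proof.
move=> Tr sT; have [|phi phiP] := @curve_supporting R d T sT.
  by move=> u /Tr/r01.
have phi_le x : P x -> phi x <= 1.
  apply: convex_hull_le => {}x /=;
    rewrite mem_cat => /orP[] /mapP[t /r01/phiP[/andP[h0 h1] _] ->] //.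
  by rewrite linearN; lra.
have phi_r : {in r, forall t,
  0 <= phi (curve t) /\ (phi (curve t) == 1) = (t \in T)}.
  by move=> t /r01/phiP[/andP[]].
exists phi; split=> //; rewrite face_polytope //; congr convex_hull.
apply/seteqP; split=> x /=; rewrite mem_filter.
  move=> /andP[/eqP x1]; rewrite mem_cat => /orP[] /mapP[t tr xE].
    by rewrite xE map_f //; have [_ <-] := phi_r t tr; rewrite -x1 xE.
  by move: x1; rewrite xE linearN; have [h0 _] := phi_r t tr; lra.
move=> /mapP[t tT ->]; have [_ ->] := phi_r _ (Tr _ tT).
by rewrite tT mem_cat map_f // Tr.
Qed.

Lemma curve_inj : {in r &, injective (@curve R d)}.
Proof.
move=> t t' tr t'r tt'.
have [|//|phi [_ phi_r _]] := @sym_curve_supporting [:: t'].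
  by move=> u /[!inE] /eqP ->.
have [_ h] := phi_r _ tr; have [_ h'] := phi_r _ t'r.
by apply/eqP; move: h h'; rewrite tt' => ->; rewrite !inE eqxx.
Qed.

Lemma sym_curve_cs : centrally_symmetric P.
Proof.
have PN x : P x -> P (- x).
  move: x; apply: convex_hull_min => [x /=|x y t t01 Px Py].
    rewrite mem_cat => /orP[] /mapP[t tr ->]; apply: sub_convex_hull;
      rewrite /= mem_cat.
      by rewrite (map_f (fun t => - curve t)) // orbT.
    by rewrite opprK map_f.
  by rewrite opprD -!scalerN; apply: convex_hull_convex.
apply/seteqP; split=> [x Px|_ [x Px <-]]; last exact: PN.
by exists (- x); rewrite ?opprK //; apply: PN.
Qed.

Lemma sym_curve_vertex : vertex P = [set` V].
Proof.
apply/seteqP; split; first exact: vertex_sub.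
have curve_vertex t : t \in r -> vertex P (curve t).
  move=> tr; have [|//|phi [phi_le _ phiE]] := @sym_curve_supporting [:: t].
    by move=> u /[!inE] /eqP ->.
  exists phi, 1; split=> //; rewrite phiE -[LHS]convex_hull1; congr convex_hull.
  by apply/seteqP; split=> x /=; rewrite inE => /eqP.
move=> x /=; rewrite mem_cat => /orP[] /mapP[t tr ->];
  first exact: curve_vertex.
by apply: (vertexN sym_curve_cs); apply: curve_vertex.
Qed.

Lemma sym_curve_uniq : uniq V.
Proof.
rewrite cat_uniq !map_inj_in_uniq ?r_uniq /= ?andbT.
(* The functional for {t'} is nonnegative on the curve points and equals -1 at the antipode of
   [curve t']. *)
- apply/hasP => -[_ /mapP[t tr ->] /mapP[t' t'r tt']].
  have [|//|phi [_ phi_r _]] := @sym_curve_supporting [:: t'].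
    by move=> u /[!inE] /eqP ->.
  have [h _] := phi_r _ tr; have [_] := phi_r _ t'r.
  by rewrite -tt' linearN mem_head => /eqP; lra.
- by move=> t t' tr t'r /oppr_inj; apply: curve_inj.
- exact: curve_inj.
Qed.

(** Any d of the curve points are linearly independent, so V spans the space; as 0 lies in P, the
    affine hull of P is closed under linear combinations. *)
Lemma sym_curve_dim : (d <= size r)%N -> has_dim P d.
Proof.
move=> dr; have V_full : span V = fullv.
  have fr : free (map curve (take d r) : seq E).
    apply: curve_free; rewrite ?take_uniq //; last by rewrite size_takel.
    by apply/negP => /mem_take /r01 /andP[_]; rewrite lern1.
  apply/eqP; rewrite eqEdim subvf dimvf /dim /= mul1n.
  apply: (@leq_trans (\dim (span (map curve (take d r) : seq E)))).
    by rewrite (eqnP fr) size_map size_takel.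
  by apply/dimvS/sub_span => x /mapP[t /mem_take tr ->]; rewrite mem_cat map_f.
have P0 : P 0.
  have r_gt0 : (0 < size r)%N by apply: leq_trans dr; apply: ltnW.
  apply: (cs_0 sym_curve_cs (x := curve r`_0)).
  by apply: sub_convex_hull; rewrite /= mem_cat map_f // mem_nth.
have aff0 : affine_hull P 0 by exact: sub_affine_hull.
exists 0, fullv; split; last by rewrite dimvf /dim /= mul1n.
apply/seteqP; split=> [y _|_ [y _ <-]]; first by exists y;
  rewrite /= ?memvf ?add0r.
have := memvf y; rewrite -V_full => /(coord_span (X := in_tuple V)) ->.
apply: (big_ind (fun z => affine_hull P (0 + z))) => [|z z'|k _].
- by rewrite addr0.
- exact: affine_hull_dirD.
apply: affine_hull_dirZ => //; rewrite add0r; apply: sub_affine_hull;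
  apply: sub_convex_hull.
exact: (mem_nth 0 (ltn_ord k)).
Qed.

Lemma sym_curve_cs_polytope : (d <= size r)%N -> cs_polytope (2 * size r) P.
Proof.
move=> dr; split; [by exists [set` V]|exact: sym_curve_cs|exact:
  sym_curve_dim|].
have set1_inj : {in vertex P &, injective (fun v : E => [set v])}.
  by move=> v w _ _ vw; have : [set v] v by []; rewrite vw.
rewrite faces0E (card_eql (inj_card_eq set1_inj)) sym_curve_vertex.
have -> : (2 * size r = size V)%N by rewrite size_cat !size_map mul2n addnn.
exact: card_eq_uniq_seq sym_curve_uniq.
Qed.

(** The points over T are linearly independent and lie on phi = 1, so [has_dim_span] gives dimension
    |T| - 1. *)
Lemma sym_curve_face T j : {subset T <= r} -> uniq T -> size T = j.+1 ->
  (2 * size T <= d)%N -> faces j P (convex_hull [set` map curve T]).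
Proof.
move=> Tr uT sT Td; have [phi [phi_le phi_r phiE]] := sym_curve_supporting Tr
  Td.
split; first by exists phi, 1; rewrite -phiE.
have fT : free (map curve T : seq E).
  apply: curve_free => //; last by lia.
  by apply/negP => /Tr /r01 /andP[_]; rewrite lern1.
have := @has_dim_span R d phi 1 (map curve T) (convex_hull [set` map curve T])
  (oner_neq0 _).
rewrite (eqnP fT) size_map sT; apply.
- case: T Tr {uT} sT {Td phi_r phiE fT} => // t T _ _; exists (curve t).
  by apply: sub_convex_hull; rewrite /= mem_head.
- exact: sub_convex_hull.
- move=> x Tx; split; first by apply: convex_hull_span Tx => y /memv_span.
  by move: Tx; rewrite -phiE => -[].
Qed.

(** Each set of i + 1 parameters gives an i-face. Distinct sets give distinct faces, because among
    the curve points only those over T reach the value 1 of the functional for T. *)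
Lemma sym_curve_card_faces i m : (2 * i.+1 <= d)%N ->
  (faces i P #= `I_m)%card -> ('C(size r, i.+1) <= m)%N.
Proof.
move=> id Pm; pose pt (k : 'I_(size r)) := r`_k.
have pt_inj : injective pt.
  by move=> k l /eqP; rewrite /pt nth_uniq // => /eqP /val_inj.
have pt_r k : pt k \in r by exact: mem_nth.
pose pts (S : {set 'I_(size r)}) := [seq pt k | k <- enum S].
pose F S : set E := convex_hull [set` map curve (pts S)].
have pts_mem S k : (pt k \in pts S) = (k \in S) by rewrite mem_map ?mem_enum.
have pts_sub S : {subset pts S <= r} by move=> _ /mapP[k _ ->]; apply: pt_r.
have pts_uniq S : uniq (pts S) by rewrite map_inj_uniq ?enum_uniq.
pose D := finset (fun S : {set 'I_(size r)} => #|S| == i.+1).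
have pts_size S : S \in D -> size (pts S) = i.+1.
  by rewrite inE => /eqP <-; rewrite size_map -cardE.
have F_inj : {in D &, injective F}.
  move=> S S' SD S'D FF; apply/finset.setP => k.
  have mem S1 S2 : S1 \in D -> F S1 = F S2 -> S2 \in D -> k \in S1 -> k \in S2.
    move=> D1 F12 D2 k1.
    have [|phi [_ phi_r phiE]] := sym_curve_supporting (@pts_sub S2);
      first by rewrite pts_size.
    have : F S1 (curve (pt k)) by apply: sub_convex_hull;
      rewrite /= map_f // pts_mem.
    rewrite F12 /F -phiE => -[_ /= phi1].
    by have [_] := phi_r _ (pt_r k); rewrite phi1 eqxx pts_mem => <-.
  by apply/idP/idP; apply: mem.
rewrite -[X in 'C(X, _)]card_ord -card_draws -(card_fset_set Pm) -/D cardE.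
have finF : finite_set (faces i P) by apply/finite_setP; exists m.
rewrite -(size_map F); apply: uniq_leq_size.
  by rewrite map_inj_in_uniq ?enum_uniq // => S S'; rewrite !mem_enum;
    apply: F_inj.
move=> _ /mapP[S + ->]; rewrite mem_enum => SD; rewrite in_fset_set // inE.
by apply: sym_curve_face => //; rewrite pts_size.
Qed.

End LowerBound.

(** * The maximum and the final estimates *)

Section Maximum.
Context {R : realType}.

(** [xget] meets its specification only if a maximum exists; a nonempty bounded set of naturals has
    one. *)
Lemma fmax_max d n j b : face_numbers R d n j !=set0 ->
  (forall m, face_numbers R d n j m -> (m <= b)%N) ->
  face_numbers R d n j (fmax R d n j) /\
  forall m, face_numbers R d n j m -> (m <= fmax R d n j)%N.
Proof.
move=> [m0 Fm0] Fb.
apply: (@xgetPex _ 0%N [set m | face_numbers R d n j m /\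
  forall m', face_numbers R d n j m' -> (m' <= m)%N]).
have ex : exists m, `[< face_numbers R d n j m >] by exists m0; apply/asboolP.
have ub m : `[< face_numbers R d n j m >] -> (m <= b)%N by move=> /asboolP/Fb.
case: (ex_maxnP ex ub) => m /asboolP Fm max_m; exists m; split=> // m' Fm'.
by apply: max_m; apply/asboolP.
Qed.

Lemma exists_face_number d m i : (d <= m)%N -> (2 * i.+2 <= d)%N ->
  exists2 f, face_numbers R d (2 * m) i.+1 f & ('C(m, i.+2) <= f)%N.
Proof.
move=> dm id; have d2 : (1 < d)%N by lia.
(* Any m distinct parameters in [0, 1] would do. *)
pose r := [seq k%:R / m%:R : R | k <- iota 0 m].
have m0 : 0 < m%:R :> R by rewrite ltr0n; apply: leq_trans dm; apply: ltnW.
have sr : size r = m by rewrite size_map size_iota.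
have r_uniq : uniq r.
  rewrite map_inj_uniq ?iota_uniq // => k l /divIf;
    rewrite gt_eqF // => /(_ isT)/eqP.
  by rewrite eqr_nat => /eqP.
have r01 : {in r, forall t, 0 <= t <= 1}.
  move=> _ /mapP[k + ->]; rewrite mem_iota add0n => /andP[_ km].
  by rewrite divr_ge0 // ler_pdivrMr // mul1r ler_nat ltnW.
have Pcs := sym_curve_cs_polytope r_uniq r01 d2; rewrite sr in Pcs.
(* Only the finiteness of the number of faces is taken from here. *)
have [|f [Pf _]] := card_faces_le _ (Pcs dm) (i := i); first by lia.
exists f; first by eexists; [exact: Pcs|exact: Pf].
by rewrite -{1}sr; apply: sym_curve_card_faces Pf.
Qed.

End Maximum.

Theorem theorem1p4 (R : realType) (d k j : nat)
  (hk : (0 < k)%N) (hd : d = (2 * k)%N) (hj : (1 <= j <= k - 1)%N) :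
  exists2 c : R, 0 < c &
    exists e1 e2 : nat -> R,
      [/\ e1 n @[n --> \oo] --> (0 : R),
          e2 n @[n --> \oo] --> (0 : R) &
          forall n : nat, cs_polytope_exists R d n ->
            c + e1 n <= (fmax R d n j)%:R / ('C(n, j.+1))%:R
                     <= 1 - 1 / 2 ^+ d + e2 n].
Proof.
case: j hj => // i /andP[_ ik].
(* The constant 4 ^ (j + 1) is the one in [leq_bin_double], comparing C(2 m, j + 1) with C(m, j +
   1). *)
pose c : R := (4 ^+ i.+2)^-1; have c0 : 0 < c by rewrite invr_gt0 exprn_gt0.
(* The construction needs m >= d antipodal pairs; for n < 2 d the error term cancels c, leaving the
   lower bound 0. The upper bound holds without error. *)
exists c => //; exists (fun n => if (n < 2 * d)%N then - c else 0), (fun=> 0);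
  split.
- apply: cvg_near_cst; exists (2 * d)%N => // n /= dn.
  by rewrite ltnNge dn.
- exact: cvg_cst.
move=> n [P Pn]; have id : (i.+1 < d)%N by lia.
have [f0 [Pf0 _]] := card_faces_le id Pn.
have upper m : face_numbers R d n i.+1 m ->
    (2 ^ d * m <= (2 ^ d - 1) * 'C(n, i.+2))%N.
  move=> [Q Qn Qm]; have [m' [Qm' le_m']] := card_faces_le id Qn.
  suff -> : m = m' by [].
  by apply/card_eq_II; rewrite (card_eql (card_esym Qm)).
have [|m Fm|Ff fmaxP] := @fmax_max R d n i.+1 ((2 ^ d - 1) * 'C(n, i.+2)).
- by exists f0, P.
- by apply: leq_trans (upper _ Fm); rewrite leq_pmull // expn_gt0.
have pow2 : 0 < 2 ^+ d :> R by rewrite exprn_gt0.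
apply/andP; split; last first.
  (* If the binomial coefficient is 0, the quotient is 0 by convention, and 1 - 1 / 2 ^ d is
     nonnegative. *)
  rewrite addr0; have [->|C0] := posnP 'C(n, i.+2).
    by rewrite invr0 mulr0 subr_ge0 ler_pdivrMr // mul1r exprn_ege1 // ler1n.
  rewrite ler_pdivrMr ?ltr0n // -(ler_pM2l pow2) mulrA mulrBr mulr1 mulrCA
    divff ?gt_eqF // mulr1.
  have := upper _ Ff; rewrite -(ler_nat R) !natrM natrB ?expn_gt0 // natrX;
    exact.
have [nd|dn] := ltnP n (2 * d).
  by rewrite subrr divr_ge0.
rewrite addr0; have [m nE] : exists m, n = (2 * m)%N.
  have := cs_polytope_even _ Pn; rewrite -dvdn2 => /(_ _)/dvdnP[]; first by lia.
  by move=> m ->; exists m; rewrite mulnC.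
rewrite nE in dn Pn Ff fmaxP *.
(* Here 2 (i + 2) <= d is the hypothesis j <= k - 1, with j = i + 1 and d = 2 k. *)
have [||f Ff' mf] := @exists_face_number R d m i; [lia|lia|].
have := leq_trans mf (fmaxP _ Ff') => {}mf.
have C0 : (0 < 'C(2 * m, i.+2))%N by rewrite bin_gt0; lia.
rewrite ler_pdivlMr ?ltr0n // /c mulrC ler_pdivrMr ?exprn_gt0 // -natrX -natrM
  ler_nat.
apply: leq_trans (leq_bin_double _) _; first by lia.
by rewrite mulnC leq_mul2r mf orbT.
Qed.
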